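(* For every integer $n\ge 1$, $$m_{1,4}^o(n) = \begin{cases} m_{3,4}^e(n) & \text{if $n$ is odd,} \\ m_{3,4}^e(n) + q^o(n/2) & \text{if $n$ is even,} \end{cases}$$ and $$m_{1,4}^e(n) = \begin{cases} m_{3,4}^o(n) & \text{if $n$ is odd,} \\ m_{3,4}^o(n) + q^e(n/2) & \text{if $n$ is even.} \end{cases}$$
   Context: A partition of a positive integer $n$ is a finite weakly decreasing sequence of positive integers with sum $n$; its length is its number of parts. The mex of a partition is the smallest positive integer that is not one of its parts. For $a\in\{1,3\}$, $m_{a,4}^o(n)$ (respectively $m_{a,4}^e(n)$) is the number of partitions of $n$ whose mex is congruent to $a$ modulo $4$ and whose length is odd (respectively even). $q^o(n)$ (respectively $q^e(n)$) is the number of partitions of $n$ into distinct parts with an odd (respectively even) number of parts. *)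

(* Defs.v *)
From mathcomp Require Import all_boot.
Set Implicit Arguments.
Unset Strict Implicit.
Unset Printing Implicit Defensive.

Definition is_partition (n : nat) (s : seq nat) : bool :=
  [&& sorted geq s, all (fun i => 0 < i) s & sumn s == n].

Lemma ex_mex (s : seq nat) : exists k, (0 < k) && (k \notin s).
Proof.
exists (\max_(i <- s) i).+1; rewrite /=; apply/negP => s_max.
by have := @leq_bigmax_seq _ s xpredT id _ s_max isT; rewrite ltnn.
Qed.

Definition mex (s : seq nat) : nat := ex_minn (ex_mex s).

(* A partition of n has at most n parts, each at most n, so it is the image
   of a unique sequence of length at most n over 'I_n.+1: see bparts_inj and
   is_partition_bseq. *)
Definition bparts (n : nat) (s : n.-bseq 'I_n.+1) : seq nat :=
  [seq val i | i <- s].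

Definition num_partitions (n : nat) (P : pred (seq nat)) : nat :=
  #|[set s : n.-bseq 'I_n.+1 | is_partition n (bparts s) && P (bparts s)]|.

Lemma bparts_inj (n : nat) : injective (@bparts n).
Proof. by move=> s t /(inj_map val_inj) /val_inj. Qed.

Lemma is_partition_bseq (n : nat) (s : seq nat) :
  is_partition n s -> exists t : n.-bseq 'I_n.+1, bparts t = s.
Proof.
case/and3P=> _ s_gt0 /eqP s_sum.
have le_size : size s <= n.
  rewrite -s_sum; elim: s s_gt0 {s_sum} => //= i s IHs /andP[i_gt0 s_gt0].
  by rewrite -add1n leq_add // IHs.
have le_part i : i \in s -> i <= n.
  rewrite -s_sum; elim: s {s_gt0 s_sum le_size} => //= j s IHs.
  rewrite inE => /predU1P[-> | /IHs le_i]; first exact: leq_addr.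
  exact: leq_trans le_i (leq_addl _ _).
have size_t : size [seq inord i : 'I_n.+1 | i <- s] <= n by rewrite size_map.
exists (Bseq size_t); rewrite /bparts /= -map_comp -[RHS]map_id.
by apply/eq_in_map => i /le_part le_i /=; rewrite inordK.
Qed.

Definition m_odd (a n : nat) : nat :=
  num_partitions n (fun s => (mex s == a %[mod 4]) && odd (size s)).

Definition m_even (a n : nat) : nat :=
  num_partitions n (fun s => (mex s == a %[mod 4]) && ~~ odd (size s)).

Definition q_odd (n : nat) : nat :=
  num_partitions n (fun s => uniq s && odd (size s)).

Definition q_even (n : nat) : nat :=
  num_partitions n (fun s => uniq s && ~~ odd (size s)).

(* Main.v *)
(** Let z = 1 or z = -1, and weigh each partition by z to its length; its
generating function is P = 1 / prod_{i >= 1} (1 - z x^i).  The partitions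
with mex j have generating function z^(j-1) x^(j(j-1)/2) (1 - z x^j) P.
Adding those with j = 2k+1, with coefficient (-z)^k (which is 1 or -z
according to the parity of k), gives P times the theta series
sum_s (-z x)^(s(s+1)/2).  By Gauss's identity at y = -z x,
  sum_s y^(s(s+1)/2) = prod_i (1 - y^(2i)) / (1 - y^(2i-1)),
this is prod_i (1 + z x^(2i)), which generates the partitions of n/2 into
distinct parts.  The cases z = 1 and z = -1 together give the theorem.
Power series are truncated: the ambient ring is R[X]/(X^N) with N > n. *)
Require Import Defs.
From mathcomp Require Import all_boot.
From mathcomp Require Import all_algebra.
From mathcomp Require Import ring zify.
Set Implicit Arguments.
Unset Strict Implicit.
Unset Printing Implicit Defensive.
Import GRing.Theory.
Local Open Scope ring_scope.

(** * Gauss's triangular number identity in finite form *)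

Lemma tri_double m : 'C(m.*2.+1, 2) = (m * m.*2.+1)%N.
Proof. by rewrite bin2odd /= ?odd_double // half_double mulnC. Qed.

Lemma tri_doubleS m : 'C(m.*2.+2, 2) = (m * m.*2.+1 + m.*2.+1)%N.
Proof. by rewrite binS bin1 tri_double. Qed.

(* Shanks' finite form of Gauss's identity, cleared of denominators. *)
Lemma gauss_finite (R : comNzRingType) (y : R) m :
  \sum_(0 <= s < m) (\prod_(s <= i < m) (1 - y ^+ i.+1.*2)) *
     (\prod_(0 <= i < s) (1 - y ^+ i.*2.+1)) * y ^+ (s * m.*2.+1) =
  (\prod_(0 <= i < m) (1 - y ^+ i.*2.+1)) * \sum_(0 <= s < m.*2) y ^+ 'C(s.+1, 2).
Proof.
elim: m => [|m IHm]; first by rewrite !big_geq ?mulr0.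
(* The summands for m + 1 and m differ by a telescoping term. *)
pose U s := \prod_(s <= i < m) (1 - y ^+ i.+1.*2) *
  \prod_(0 <= i < s) (1 - y ^+ i.*2.+1) * (1 - y ^+ s.*2) * y ^+ (s * m.*2.+1).
have step s : (0 <= s < m)%N ->
  \prod_(s <= i < m.+1) (1 - y ^+ i.+1.*2) *
     (\prod_(0 <= i < s) (1 - y ^+ i.*2.+1)) * y ^+ (s * m.+1.*2.+1) =
  (1 - y ^+ m.*2.+1) * (\prod_(s <= i < m) (1 - y ^+ i.+1.*2) *
     (\prod_(0 <= i < s) (1 - y ^+ i.*2.+1)) * y ^+ (s * m.*2.+1))
  + (U s.+1 - U s).
  move=> /andP[_ lt_sm]; rewrite /U big_nat_recr 1?ltnW //= (big_ltn lt_sm).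
  rewrite [in X in _ + (X - _)]big_nat_recr //=.
  set A := \prod_(s.+1 <= i < m) _; set O := \prod_(0 <= i < s) _.
  have -> : (s * m.+1.*2.+1 = s * m.*2.+1 + s.*2)%N by lia.
  have -> : (s.+1 * m.*2.+1 = s * m.*2.+1 + m.*2.+1)%N by lia.
  have -> : (m.+1.*2 = m.*2.+1 + 1)%N by lia.
  have -> : (s.+1.*2 = s.*2 + 2)%N by lia.
  rewrite -[s.*2.+1]addn1 !exprD !expr1.
  set a := y ^+ s.*2; set b := y ^+ m.*2.+1; set c := y ^+ (_ * _); ring.
rewrite big_nat_recr //= (eq_big_nat _ _ step) big_split /= -mulr_sumr IHm telescope_sumr // big_nat1.
(* [U 0] vanishes by its factor [1 - y ^+ 0]; [U m] and the new summand at [s = m] supply the next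
   two triangular powers. *)
rewrite /U [\prod_(m <= i < m) _]big_geq // double0 expr0 subrr mulr0 mul0r subr0 mul1r.
rewrite doubleS !(big_nat_recr m.*2.+1, big_nat_recr m.*2, big_nat_recr m) //=.
set O := \prod_(0 <= i < m) _; set S := \sum_(0 <= s < _) _.
rewrite tri_doubleS tri_double.
have -> : (m * m.+1.*2.+1 = m * m.*2.+1 + m.*2)%N by lia.
rewrite -[m.*2.+2]addn2 -[m.*2.+1]addn1 !exprD !expr1.
set a := y ^+ m.*2; set c := y ^+ (_ * _); ring.
Qed.

Lemma prod_double (R : comNzRingType) (f : nat -> R) m :
  \prod_(0 <= i < m.*2) f i = \prod_(0 <= i < m) (f i.*2 * f i.*2.+1).
Proof.
elim: m => [|m IHm]; first by rewrite !big_geq.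
by rewrite doubleS !(big_nat_recr m.*2.+1, big_nat_recr m.*2, big_nat_recr m) //= IHm mulrA.
Qed.

(** * Theta series at a nilpotent argument *)

Definition geom (R : comNzRingType) N (w : R) := \sum_(c < N) w ^+ c.

Lemma geomK (R : comNzRingType) N (w : R) : w ^+ N = 0 -> (1 - w) * geom N w = 1.
Proof. by move=> wN0; rewrite -opprB mulNr -subrX1 wN0 sub0r opprK. Qed.

Lemma expr_nil_ge (R : comNzRingType) N (x : R) k : x ^+ N = 0 -> (N <= k)%N -> x ^+ k = 0.
Proof. by move=> xN0 /subnKC <-; rewrite exprD xN0 mul0r. Qed.

Lemma expr_mul_nil (R : comNzRingType) N (x z : R) k : x ^+ N = 0 -> (z * x ^+ k.+1) ^+ N = 0.
Proof. by move=> xN0; rewrite exprMn -exprM mulnC exprM xN0 expr0n mulr0. Qed.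

(** In the finite form at [m = N], each summand with [s > 0] carries a power of [y] of exponent at
    least [N] and vanishes; only [s = 0] remains. *)
Lemma gauss_truncated (R : comNzRingType) N (y : R) : y ^+ N = 0 ->
  (\prod_(0 <= i < N) (1 - y ^+ i.*2.+1)) * \sum_(0 <= s < N.*2) y ^+ 'C(s.+1, 2) =
  \prod_(0 <= i < N) (1 - y ^+ i.+1.*2).
Proof.
case: N => [/eqP|N yN0]; first by rewrite expr0 oner_eq0.
rewrite -gauss_finite [LHS]big_ltn // [\prod_(0 <= i < 0) _]big_geq //= mul0n expr0 !mulr1.
rewrite [\sum_(1 <= _ < _) _]big_nat [\sum_(1 <= _ < _ | _) _]big1 ?addr0 // => s /andP[s_gt0 _].
by rewrite (@expr_nil_ge _ N.+1) ?mulr0 //; nia.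
Qed.

(** Gauss's identity at [y = - z * x]: odd powers of [y] keep a factor [- z], even ones lose it. The
    factors [1 - z x^i] and [1 + z x^i] then combine to [1 - x^(2i)]. *)
Lemma theta_prod (R : comNzRingType) N (x z : R) : z ^+ 2 = 1 -> x ^+ N = 0 ->
  (\prod_(0 <= i < N.*2) geom N (z * x ^+ i.+1)) *
    \sum_(0 <= s < N.*2) (- z * x) ^+ 'C(s.+1, 2) =
  \prod_(0 <= i < N) (1 + z * x ^+ i.+1.*2).
Proof.
move=> zz xN0.
have z_even k : (- z) ^+ k.*2 = 1 by rewrite -mul2n exprM sqrrN zz expr1n.
have z_odd k : (- z) ^+ k.*2.+1 = - z by rewrite exprS z_even mulr1.
have yN0 : (- z * x) ^+ N = 0 by rewrite exprMn xN0 mulr0.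
set P := \prod_(0 <= i < _) geom _ _; set T := \sum_(_ <= s < _) _.
set Q := RHS.
have PK : (\prod_(0 <= i < N.*2) (1 - z * x ^+ i.+1)) * P = 1.
  by rewrite -big_split /= big1 // => i _; rewrite geomK ?expr_mul_nil.
(* O = prod (1 - y^(2i+1)) is invertible since x is nilpotent; cancel it. *)
pose O := \prod_(0 <= i < N) (1 + z * x ^+ i.*2.+1).
have [V VO] : exists V, V * O = 1.
  exists (\prod_(0 <= i < N) geom N (- z * x ^+ i.*2.+1)).
  rewrite /O -big_split /= big1 // => i _.
  by rewrite mulrC -[RHS](@geomK _ N (- z * x ^+ i.*2.+1)) ?expr_mul_nil // mulNr opprK.
suff : O * T = O * ((\prod_(0 <= i < N.*2) (1 - z * x ^+ i.+1)) * Q).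
  move/(congr1 ( *%R V)); rewrite !mulrA VO !mul1r => ->.
  by rewrite mulrA [P * _]mulrC PK mul1r.
have -> : O * T = \prod_(0 <= i < N) (1 - x ^+ i.+1.*2).
  have -> : O = \prod_(0 <= i < N) (1 - (- z * x) ^+ i.*2.+1).
    by apply: eq_bigr => i _; rewrite exprMn z_odd mulNr opprK.
  by rewrite gauss_truncated //; apply: eq_bigr => i _; rewrite exprMn z_even mul1r.
rewrite prod_double mulrC -!mulrA -!big_split /=.
(* The factors added from [N] up to [N.*2] are 1, since their powers of [x] vanish; the range now
   matches the paired factors. *)
transitivity (\prod_(0 <= i < N.*2) (1 - x ^+ i.+1.*2)).
  rewrite (@big_cat_nat _ _ _ N _ N.*2) //=; last by lia.
  rewrite [X in _ = _ * X]big_nat [X in _ = _ * X]big1 ?mulr1 // => i /andP[Ni _].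
  by rewrite (@expr_nil_ge _ N) ?subr0 //; lia.
rewrite prod_double; apply: eq_bigr => i _.
have -> : (i.*2.+1.*2 = i.*2.+1 * 2)%N by lia.
have -> : (i.*2.+2.*2 = i.*2.+2 * 2)%N by lia.
rewrite !exprM -doubleS.
set a := x ^+ i.*2.+1; set b := x ^+ i.+1.*2.
transitivity ((1 - z ^+ 2 * a ^+ 2) * (1 - z ^+ 2 * b ^+ 2)); last by ring.
by rewrite zz !mul1r.
Qed.

(** Term [k] on the left splits into terms [2k] and [2k+1] on the right: the exponent [k(2k+1)] has
    the parity of [k], and [- z] has square 1. *)
Lemma theta_pair (R : comNzRingType) (x z : R) m : z ^+ 2 = 1 ->
  \sum_(0 <= k < m) (- z) ^+ k * x ^+ 'C(k.*2.+1, 2) * (1 - z * x ^+ k.*2.+1) =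
  \sum_(0 <= s < m.*2) (- z * x) ^+ 'C(s.+1, 2).
Proof.
move=> zz; have z_even k : (- z) ^+ k.*2 = 1 by rewrite -mul2n exprM sqrrN zz expr1n.
elim: m => [|m IHm]; first by rewrite !big_geq.
rewrite doubleS !(big_nat_recr m.*2.+1, big_nat_recr m.*2, big_nat_recr m) //= IHm.
rewrite -addrA; congr (_ + _); rewrite tri_doubleS !tri_double !exprMn !exprD.
have -> : (- z) ^+ (m * m.*2.+1) = (- z) ^+ m.
  by rewrite mulnS -mulnC -doubleMl exprD z_even mulr1.
by rewrite [(- z) ^+ m.*2.+1]exprS z_even; ring.
Qed.

(** * Partitions and their multiplicities *)

Lemma sum_count_mem (F : nat -> nat) M (s : seq nat) :
  all (fun k => 0 < k <= M)%N s ->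
  (\sum_(k <- s) F k = \sum_(i < M) F i.+1 * count_mem i.+1 s)%N.
Proof.
elim: s => [|k s IHs] /=; first by rewrite big_nil big1 // => i _; rewrite muln0.
case/andP=> /andP[k_gt0 le_kM] /IHs sE; rewrite big_cons sE.
under [RHS]eq_bigr do rewrite mulnDr.
rewrite big_split /=; congr (_ + _)%N.
have lt_kM : (k.-1 < M)%N by rewrite prednK.
rewrite (bigD1 (Ordinal lt_kM)) //= prednK // eqxx muln1 big1 ?addn0 // => i.
rewrite -val_eqE /= => ne_ik; case: eqP => [k_eq|_]; last by rewrite muln0.
by rewrite k_eq eqxx in ne_ik.
Qed.

Lemma partition_parts n s : is_partition n s -> all (fun k => 0 < k <= n)%N s.
Proof.
case/and3P=> _ s_gt0 /eqP <-; apply/allP => k s_k; rewrite (allP s_gt0) //=.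
by rewrite sumnE (big_rem k) //= leq_addr.
Qed.

Lemma count_partition n s k : is_partition n s -> (count_mem k s <= n)%N.
Proof.
move=> /is_partition_bseq[t <-]; apply: leq_trans (count_size _ _) _.
by rewrite size_map size_bseq.
Qed.

Lemma partition_eq n s t : is_partition n s -> is_partition n t ->
  (forall k, (0 < k <= n)%N -> count_mem k s = count_mem k t) -> s = t.
Proof.
move=> s_n t_n eq_count.
have [s_sorted _ _] := and3P s_n; have [t_sorted _ _] := and3P t_n.
apply: (@sorted_eq _ geq) => //.
- by move=> ? ? ? /= le1 le2; apply: leq_trans le2 le1.
- by move=> i j; rewrite /= andbC -eqn_leq => /eqP.
apply/allP => k k_st /=; rewrite eq_count //.
move: k_st; rewrite mem_cat => /orP[]; [exact: (allP (partition_parts s_n))|].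
exact: (allP (partition_parts t_n)).
Qed.

Lemma partition_of_counts M (f : 'I_M -> nat) :
  exists2 s, is_partition (\sum_(i < M) i.+1 * f i) s &
    forall i : 'I_M, count_mem i.+1 s = f i.
Proof.
pose u := flatten [seq nseq (f i) i.+1 | i : 'I_M].
exists (sort geq u) => [|i].
  apply/and3P; split.
  - by apply: sort_sorted => i j; exact: leq_total.
  - rewrite all_sort; apply/allP => k /flattenP[_ /mapP[i _ ->]].
    by move=> /nseqP[->].
  rewrite (perm_sumn (permEl (perm_sort _ _))) sumn_flatten -map_comp sumnE.
  by rewrite big_map big_enum; apply/eqP/eq_bigr => i _; rewrite /= sumn_nseq.
rewrite (permP (permEl (perm_sort _ _))) count_flatten -map_comp sumnE.
rewrite big_map big_enum (bigD1 i) //= count_nseq /= eqxx mul1n big1 ?addn0 // => j.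
by rewrite -val_eqE count_nseq /= eqSS => /negPf->.
Qed.

(** A coefficient of a generating function weighted by length: at [z = 1] a count, at [z = -1] the
    even lengths minus the odd ones. *)
Definition wsum (R : comNzRingType) (z : R) n (P : pred (seq nat)) : R :=
  \sum_(s : n.-bseq 'I_n.+1 | is_partition n (bparts s) && P (bparts s)) z ^+ size s.

(** Expanding the product chooses a multiplicity [c] for each part size [i.+1]. With [n <= M] no
    part size is missing, and with [n < B] no multiplicity is cut off. *)
Lemma coef_prod_parts (R : comNzRingType) (z : R) n M B (A : nat -> pred nat) :
  (n <= M)%N -> (n < B)%N ->
  (\prod_(0 <= i < M) \sum_(c < B | A i.+1 c) (z%:P * 'X ^+ i.+1) ^+ c)`_n =
  wsum z n (fun s => [forall i : 'I_M, A i.+1 (count_mem i.+1 s)]).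
Proof.
move=> le_nM lt_nB; rewrite big_mkord bigA_distr_big_dep coef_sum.
case: B lt_nB => // B lt_nB.
pose wt (f : {ffun 'I_M -> 'I_B.+1}) := (\sum_(i < M) i.+1 * f i)%N.
have coefE (f : {ffun 'I_M -> 'I_B.+1}) :
    (\prod_(i < M) (z%:P * 'X ^+ i.+1) ^+ f i)`_n = if wt f == n then z ^+ (\sum_(i < M) f i) else 0.
  under eq_bigr do rewrite exprMn -exprM -rmorphXn /=.
  rewrite big_split /= -rmorph_prod /= !prodrXr coefCM coefXn eq_sym.
  by case: eqP; rewrite ?mulr1 ?mulr0.
under eq_bigr do rewrite coefE; rewrite -big_mkcondr /=.
pose h (s : n.-bseq 'I_n.+1) : {ffun 'I_M -> 'I_B.+1} :=
  [ffun i : 'I_M => inord (count_mem i.+1 (bparts s))].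
(* The default [[bseq]] is never reached when [wt f = n]: [partition_of_counts] then provides a
   preimage. *)
pose h' (f : {ffun 'I_M -> 'I_B.+1}) : n.-bseq 'I_n.+1 :=
  odflt [bseq] [pick s | is_partition n (bparts s) && (h s == f)].
have hE s : is_partition n (bparts s) -> forall i, h s i = count_mem i.+1 (bparts s) :> nat.
  move=> s_n i; rewrite ffunE inordK // ltnS.
  exact: leq_trans (count_partition _ s_n) _.
have parts_M s : is_partition n s -> all (fun k => 0 < k <= M)%N s.
  move/partition_parts; apply: sub_all => k /andP[-> le_kn].
  exact: leq_trans le_kn le_nM.
have h'P f : wt f = n -> is_partition n (bparts (h' f)) /\ h (h' f) = f.
  move=> wt_f; rewrite /h'; case: pickP => [s /andP[? /eqP] //|no_s].
  have [s] := partition_of_counts (fun i => val (f i)); rewrite -/(wt f) wt_f => s_n s_f.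
  have [t t_s] := is_partition_bseq s_n.
  have /negP[] := negbT (no_s t); rewrite t_s s_n /=; apply/eqP/ffunP => i.
  by apply/val_inj; rewrite /= hE t_s.
rewrite (reindex_onto h h') => [|f /andP[_ /eqP wt_f]]; last by case: (h'P f).
have wt_h s : is_partition n (bparts s) -> wt (h s) = n.
  move=> s_n; have [_ _ /eqP s_sum] := and3P s_n.
  rewrite -[RHS]s_sum sumnE (sum_count_mem (fun k => k) (parts_M _ s_n)).
  by apply: eq_bigr => i _; rewrite hE.
apply: eq_big => [s | s /andP[/andP[_ /eqP wt_s] /eqP hK]].
  apply/andP/andP => [[/andP[/familyP A_s /eqP wt_s] /eqP hK] | [s_n /forallP A_s]].
    have [s_n _] := h'P _ wt_s; rewrite hK in s_n; split=> //.
    by apply/forallP => i; have := A_s i; rewrite unfold_in hE.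
  rewrite wt_h // eqxx andbT; split.
    by apply/familyP => i; rewrite unfold_in hE.
  (* Both [h' (h s)] and [s] have the multiplicities [h s], and these determine a partition. *)
  have [s'_n hs'] := h'P _ (wt_h _ s_n); apply/eqP/bparts_inj.
  apply: (partition_eq s'_n s_n) => -[//|k] /andP[_ lt_kn].
  have lt_kM := leq_trans lt_kn le_nM.
  by rewrite -!(hE _ _ (Ordinal lt_kM)) ?hs'.
have [s_n _] := h'P _ wt_s; rewrite hK in s_n.
rewrite -[X in _ = _ ^+ X](size_map val) -/(bparts s) -sum1_size.
rewrite (sum_count_mem (fun _ => 1%N) (parts_M _ s_n)); congr (z ^+ _).
by apply: eq_bigr => i _; rewrite mul1n hE.
Qed.

(** * The mex in terms of multiplicities *)

(* mex s = j says that every i has a multiplicity in s lying in mex_mult j i. *)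
Definition mex_mult (j i : nat) : pred nat :=
  fun c => if (i < j)%N then (0 < c)%N else (i != j) || (c == 0)%N.

Lemma mex_eq j s : (0 < j)%N ->
  (mex s == j) = all (mem s) (iota 1 j.-1) && (j \notin s).
Proof.
move=> j_gt0; rewrite /mex; case: ex_minnP => m /andP[m_gt0 m_s] m_min.
apply/eqP/andP => [<-|[/allP s_j j_s]].
  split=> //; apply/allP => k; rewrite mem_iota => /andP[k_gt0 lt_km] /=.
  by apply: contraT => k_s; have := m_min k; rewrite k_gt0 k_s => /(_ isT); lia.
apply/eqP; rewrite eqn_leq m_min ?j_gt0 //= leqNgt; apply: contra m_s => lt_mj.
by apply: s_j; rewrite mem_iota; lia.
Qed.

(** Sizes beyond [j] are unconstrained, so the multiplicities up to any [M >= j] decide whether the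
    mex is [j]. *)
Lemma mex_counts j M s : (0 < j <= M)%N ->
  (mex s == j) = [forall i : 'I_M, mex_mult j i.+1 (count_mem i.+1 s)].
Proof.
case/andP=> j_gt0 le_jM; rewrite mex_eq //.
apply/andP/forallP => [[/allP s_j j_s] i|s_mult].
  rewrite /mex_mult; case: ltnP => [lt_ij|_].
    by rewrite -has_count has_pred1; apply: s_j; rewrite mem_iota; lia.
  by case: eqP => //= ->; apply/eqP/count_memPn.
split; first (apply/allP => k; rewrite mem_iota => /andP[k_gt0 lt_kj]).
  have lt_kM : (k.-1 < M)%N by lia.
  have := s_mult (Ordinal lt_kM); rewrite /mex_mult /= prednK // ifT; last by lia.
  by rewrite -has_count has_pred1.
have lt_jM : (j.-1 < M)%N by lia.
have := s_mult (Ordinal lt_jM); rewrite /mex_mult /= prednK // ltnn eqxx /=.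
by move/eqP/count_memPn.
Qed.

Lemma mex_bounds n s : is_partition n s -> (0 < mex s <= n.+1)%N.
Proof.
move=> s_n; rewrite /mex; case: ex_minnP => m /andP[-> _] /=; apply.
by apply/negP => /(allP (partition_parts s_n)); rewrite ltnn andbF.
Qed.

(** The range includes [c = N] so that dropping [c = 0] leaves exactly [w * geom N w]; in the
    unrestricted case the extra term [w ^+ N] is 0. *)
Lemma geom_mex (R : comNzRingType) N (w : R) j i : w ^+ N = 0 ->
  \sum_(c < N.+1 | mex_mult j i c) w ^+ c =
  (if (i < j)%N then w else if i == j then 1 - w else 1) * geom N w.
Proof.
move=> wN0; rewrite /mex_mult; case: ltnP => [_|_].
  rewrite big_mkcond big_ord_recl /= add0r mulr_sumr.
  by apply: eq_bigr => c _; rewrite /= exprS.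
case: eqP => _ /=; last by rewrite mul1r big_ord_recr /= wN0 addr0.
rewrite geomK // big_mkcond big_ord_recl /= big1 ?addr0 //.
Qed.

(** Each size [1, ..., j] has one forced copy, which gives [z ^+ j] and the exponent [1 + ... + j];
    size [j.+1] is absent, which cancels its geometric factor. *)
Lemma prod_mex (R : comNzRingType) N (x z : R) j M : x ^+ N = 0 -> (j < M)%N ->
  \prod_(0 <= i < M) \sum_(c < N.+1 | mex_mult j.+1 i.+1 c) (z * x ^+ i.+1) ^+ c =
  z ^+ j * x ^+ 'C(j.+1, 2) * (1 - z * x ^+ j.+1) *
    \prod_(0 <= i < M) geom N (z * x ^+ i.+1).
Proof.
move=> xN0 lt_jM.
under eq_bigr do rewrite geom_mex ?expr_mul_nil //.
rewrite big_split /=; congr (_ * _).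
rewrite (@big_cat_nat _ _ _ j) ?(ltnW lt_jM) //= (big_ltn lt_jM) ltnn eqxx.
rewrite mulrA [X in _ * X]big_nat [X in _ * X]big1 => [|i /andP[lt_ji _]]; last first.
  by rewrite !ifF //; lia.
rewrite mulr1; congr (_ * _).
transitivity (\prod_(0 <= i < j) (z * x ^+ i.+1)).
  by apply: eq_big_nat => i /andP[_ lt_ij]; rewrite ltnS lt_ij.
elim: j {lt_jM} => [|j IHj]; first by rewrite big_geq // !expr0 mul1r.
by rewrite big_nat_recr //= IHj [in RHS]binS bin1 exprD [z ^+ j.+1]exprSr mulrACA.
Qed.

(** * The signed sum over odd mex values *)

Lemma qpoly_coef (R : comNzRingType) N (p q : {poly R}) n : (n < N)%N ->
  in_qpoly 'X^N p = in_qpoly 'X^N q -> p`_n = q`_n.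
Proof.
case: N => // N lt_nN /(congr1 (@polyn _ _)) /=.
rewrite mk_monic_Xn /= => eq_mod.
have coef_mod (r : {poly R}) : (Pdiv.CommonRing.rmodp r 'X^(N.+1))`_n = r`_n.
  rewrite [in RHS](Pdiv.RingMonic.rdivp_eq (monicXn R N.+1) r) coefD coefMXn.
  by rewrite lt_nN add0r.
by rewrite -[LHS]coef_mod eq_mod coef_mod.
Qed.

Lemma wsum_mex_theta (R : comNzRingType) (z : R) n : z ^+ 2 = 1 ->
  \sum_(0 <= k < n.+1) (- z) ^+ k * wsum z n (fun s => mex s == k.*2.+1) =
  (\prod_(0 <= i < n.+1) (1 + z%:P * 'X ^+ i.+1.*2))`_n.
Proof.
move=> zz; set N := n.+1.
(* Taking [N.*2] factors leaves room for every mex [k.*2.+1] with [k < N]; exponents up to [N] fit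
   [geom_mex]. *)
transitivity (\sum_(0 <= k < N) (- z%:P) ^+ k *
    \prod_(0 <= i < N.*2) \sum_(c < N.+1 | mex_mult k.*2.+1 i.+1 c)
       (z%:P * 'X ^+ i.+1) ^+ c)`_n.
  rewrite coef_sum; apply: eq_big_nat => k /andP[_ lt_kN].
  rewrite -rmorphN -rmorphXn /= coefCM coef_prod_parts; last by lia.
    congr (_ * _); apply: eq_bigl => s; congr (_ && _).
    by apply: mex_counts; rewrite /N in lt_kN *; lia.
  by rewrite /N; lia.
(* Modulo ['X^N] the indeterminate is nilpotent, as the truncated identities require, and the
   coefficient of index [n < N] survives. *)
apply: (@qpoly_coef _ N) => //.
pose x := in_qpoly 'X^N ('X : {poly R}); pose zq := in_qpoly 'X^N z%:P.
have xN0 : x ^+ N = 0.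
  rewrite /x -rmorphXn; apply/val_inj.
  by rewrite /= mk_monic_Xn /= Pdiv.RingMonic.rmodpp ?monicXn.
have zqE : zq ^+ 2 = 1 by rewrite /zq -!rmorphXn /= zz rmorph1.
rewrite rmorph_sum rmorph_prod /=.
under [RHS]eq_bigr do rewrite rmorphD rmorph1 rmorphM rmorphXn /= -/x -/zq.
rewrite -theta_prod // -theta_pair // mulrC mulr_suml.
apply: eq_big_nat => k /andP[_ lt_kN].
rewrite rmorphM rmorphXn rmorphN /= -/zq rmorph_prod /=.
under [X in _ * X = _]eq_bigr => i _.
  rewrite rmorph_sum /=.
  under eq_bigr do rewrite rmorphXn rmorphM rmorphXn /= -/x -/zq.
  over.
rewrite prod_mex //; last by lia.
(* The weight [z ^+ k.*2] of the forced copies is 1. *)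
by rewrite -[k.*2]mul2n exprM zqE expr1n mul1r !mulrA.
Qed.

Lemma mod4_odd m : odd m -> (m == 1 %[mod 4])%N = ~~ odd m./2 /\
  (m == 3 %[mod 4])%N = odd m./2.
Proof.
move=> odd_m; have mE := odd_double_half m; have hE := odd_double_half m./2.
rewrite odd_m in mE.
by case: (odd m./2) hE => hE; split=> /=; lia.
Qed.

(** Only [k = m./2] can contribute, and only for odd [m]; there [(- z) ^+ k] is 1 for even [k] and
    [- z] for odd [k]. *)
Lemma sum_mex_sign (R : comNzRingType) (z : R) n m : z ^+ 2 = 1 -> (0 < m <= n.+1)%N ->
  \sum_(0 <= k < n.+1) (if m == k.*2.+1 then (- z) ^+ k else 0) =
  (if (m == 1 %[mod 4])%N then 1 else 0) - z * (if (m == 3 %[mod 4])%N then 1 else 0).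
Proof.
move=> zz /andP[m_gt0 le_mn]; rewrite -big_mkcond big_mkord.
have mE := odd_double_half m; case: (boolP (odd m)) => odd_m; last first.
  rewrite big1 => [|k /eqP m_k]; last by rewrite m_k /= odd_double in odd_m.
  by rewrite !ifF ?mulr0 ?subr0 //; apply/eqP => m_mod; move: odd_m; lia.
have lt_mn : (m./2 < n.+1)%N by lia.
rewrite (big_pred1 (Ordinal lt_mn)) => [|k]; last first.
  by rewrite /= -val_eqE /=; apply/eqP/eqP; rewrite odd_m in mE; lia.
have [-> ->] := mod4_odd odd_m; rewrite /= -{1}(odd_double_half m./2).
rewrite -mul2n exprD exprM sqrrN zz expr1n mulr1.
by case: (odd _); rewrite ?mulr1 ?mulr0 ?sub0r ?subr0 ?expr1 ?expr0.
Qed.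

(** After exchanging the sums, a partition is met only at its own mex; as this is at most [n.+1], no
    odd value falls outside the range of [k]. *)
Lemma wsum_mex_sign (R : comNzRingType) (z : R) n : z ^+ 2 = 1 ->
  \sum_(0 <= k < n.+1) (- z) ^+ k * wsum z n (fun s => mex s == k.*2.+1) =
  wsum z n (fun s => mex s == 1 %[mod 4])%N -
    z * wsum z n (fun s => mex s == 3 %[mod 4])%N.
Proof.
have wsumE P : wsum z n P = \sum_(s : n.-bseq 'I_n.+1 | is_partition n (bparts s))
    (if P (bparts s) then z ^+ size s else 0) by rewrite /wsum big_mkcondr.
move=> zz; rewrite !wsumE mulr_sumr -sumrB.
under eq_bigr do rewrite wsumE mulr_sumr.
rewrite exchange_big /=; apply: eq_bigr => s /mex_bounds mex_n.
transitivity ((\sum_(0 <= k < n.+1)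
    (if mex (bparts s) == k.*2.+1 then (- z) ^+ k else 0)) * z ^+ size s).
  by rewrite mulr_suml; apply: eq_bigr => k _; case: ifP; rewrite ?mulr0 ?mul0r.
rewrite sum_mex_sign // mulrBl -mulrA.
by congr (_ - _ * _); case: ifP; rewrite ?mul1r ?mul0r.
Qed.

(** * Distinct parts and the parity of the length *)

Lemma uniq_counts n s : is_partition n s ->
  uniq s = [forall i : 'I_n, (count_mem i.+1 s <= 1)%N].
Proof.
move=> s_n; apply/idP/forallP => [s_uniq i|s_le1].
  by rewrite count_uniq_mem //; case: (_ \in _).
apply: count_mem_uniq => k; case: (boolP (k \in s)) => [k_s|/count_memPn //].
have /andP[k_gt0 le_kn] := allP (partition_parts s_n) _ k_s.
have lt_kn : (k.-1 < n)%N by rewrite prednK.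
apply/eqP; rewrite eqn_leq -has_count has_pred1 k_s andbT.
by have := s_le1 (Ordinal lt_kn); rewrite /= prednK.
Qed.

Lemma coef_prod_distinct (R : comNzRingType) (z : R) n :
  (\prod_(0 <= i < n) (1 + z%:P * 'X ^+ i.+1))`_n = wsum z n uniq.
Proof.
(* The bound [n.+2] keeps both exponents 0 and 1 available even for [n = 0]. *)
transitivity (\prod_(0 <= i < n)
   \sum_(c < n.+2 | (c <= 1)%N) (z%:P * 'X ^+ i.+1) ^+ c)`_n.
  congr (nth 0 (polyseq _) n); apply: eq_bigr => i _; rewrite big_mkcond !big_ord_recl /=.
  by rewrite big1 ?addr0 ?expr0 ?expr1.
rewrite (@coef_prod_parts _ z n n n.+2 (fun _ c => (c <= 1)%N)) //.
by apply: eq_bigl => s; case: (boolP (is_partition _ _)) => //= s_n; rewrite (uniq_counts s_n).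
Qed.

Lemma coef_prod_high (R : comNzRingType) (f : nat -> {poly R}) n M : (n <= M)%N ->
  (\prod_(0 <= i < M) (1 + f i * 'X ^+ i.+1))`_n =
  (\prod_(0 <= i < n) (1 + f i * 'X ^+ i.+1))`_n.
Proof.
elim: M => [|M IHM]; first by rewrite leqn0 => /eqP->.
rewrite leq_eqVlt => /predU1P[-> //|lt_nM].
rewrite big_nat_recr //= mulrDr mulr1 mulrA coefD coefMXn lt_nM addr0.
by apply: IHM; rewrite -ltnS.
Qed.

(** Substituting ['X^2] into the product for distinct parts kills the odd coefficients and doubles
    the index of the others. *)
Lemma coef_prod_distinct_even (R : comNzRingType) (z : R) n :
  (\prod_(0 <= i < n.+1) (1 + z%:P * 'X ^+ i.+1.*2))`_n =
  if odd n then 0 else wsum z (n %/ 2) uniq.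
Proof.
transitivity ((\prod_(0 <= i < n.+1) (1 + z%:P * 'X ^+ i.+1)) \Po 'X^2)`_n.
  rewrite rmorph_prod /=; congr (nth 0 (polyseq _) n); apply: eq_bigr => i _.
  by rewrite comp_polyD comp_polyM !comp_polyC comp_Xn_poly -exprM mul2n.
rewrite coef_comp_poly_Xn // dvdn2; case: odd => //=.
rewrite (coef_prod_high (fun _ => z%:P)) ?coef_prod_distinct //.
by rewrite (leq_trans (leq_div _ _)).
Qed.

Lemma wsum_num (R : comNzRingType) (z : R) n P : z ^+ 2 = 1 ->
  wsum z n P = (num_partitions n (fun s => P s && ~~ odd (size s)))%:R +
    z * (num_partitions n (fun s => P s && odd (size s)))%:R.
Proof.
move=> zz; rewrite /wsum (bigID (fun s : n.-bseq 'I_n.+1 => odd (size s))) [RHS]addrC.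
have zE (s : n.-bseq 'I_n.+1) : z ^+ size s = if odd (size s) then z else 1 :> R.
  rewrite -{1}(odd_double_half (size s)) exprD -mul2n exprM zz expr1n mulr1.
  by case: odd.
rewrite /num_partitions -!sum1_card !natr_sum mulr_sumr; congr (_ + _).
  apply: eq_big => [s|s /andP[_ s_odd]]; first by rewrite inE size_map andbA.
  by rewrite zE s_odd mulr1.
apply: eq_big => [s|s /andP[_ s_odd]]; first by rewrite inE size_map andbA.
by rewrite zE (negPf s_odd).
Qed.

(** Equates two evaluations of the signed sum over odd mex values: by the residue of the mex, and by
    Gauss's identity. *)
Lemma signed_identity (z : int) n : z ^+ 2 = 1 ->
  (m_even 1 n)%:Z + z * (m_odd 1 n)%:Z - z * ((m_even 3 n)%:Z + z * (m_odd 3 n)%:Z) =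
  if odd n then 0 else (q_even (n %/ 2))%:Z + z * (q_odd (n %/ 2))%:Z.
Proof.
move=> zz; have := wsum_mex_theta n zz.
by rewrite wsum_mex_sign // coef_prod_distinct_even !wsum_num // !natz.
Qed.

Local Close Scope ring_scope.

Theorem theorem3p4 (n : nat) (hn : 1 <= n) :
  m_odd 1 n =
    (if odd n then m_even 3 n else m_even 3 n + q_odd (n %/ 2)) /\
  m_even 1 n =
    (if odd n then m_odd 3 n else m_odd 3 n + q_even (n %/ 2)).
Proof.
(* Half the sum of the cases [z = 1] and [z = -1] gives the formula for [m_even 1 n], half their
   difference that for [m_odd 1 n]. *)
have := signed_identity n (expr1n int 2); have := @signed_identity (-1)%R n erefl.
by case: odd; lia.
Qed.
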